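(* Let $N \geq 2$ and $V=\{1,\ldots,N\}$. Let $\mathcal{A}'$ be the set of all simply connected acyclic digraphs on the vertex set $V$, and let $M'$ be the Markov chain on $\mathcal{A}'$ whose transitions are defined as follows: from state $X_t$, draw a pair $(i,j)$ uniformly at random from $V\times V$; (T'1) if $(i,j)$ is an arc of $X_t$, then (i) if $(i,j)$ is not disconnecting, set $X_{t+1}=X_t\setminus\{(i,j)\}$, and (ii) if $(i,j)$ is disconnecting, set $X_{t+1}=(X_t\setminus\{(i,j)\})\cup\{(j,i)\}$; (T2) if $(i,j)$ is not an arc of $X_t$, then (i) set $X_{t+1}=X_t\cup\{(i,j)\}$ if the resulting digraph is acyclic, and (ii) otherwise set $X_{t+1}=X_t$. Then $M'$ is irreducible: for any two simply connected acyclic digraphs $G,H\in\mathcal{A}'$ there exists a sequence of transitions $G=G_0\to G_1\to\cdots\to G_p=H$ of $M'$ with $p\geq 1$ and all $G_i\in\mathcal{A}'$. Moreover, such a sequence exists with length $p$ at most $(N+7)(N-3/2)$.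
   Context: A digraph on $V$ is identified with its set of arcs (ordered pairs of vertices). It is acyclic if it contains no directed circuit $v_0,v_1,\ldots,v_k=v_0$ with each $(v_i,v_{i+1})$ an arc. It is simply connected if its underlying undirected graph (forgetting orientations) is connected. An arc of a simply connected digraph is disconnecting if removing it yields a digraph that is not simply connected. A transition $X\to Y$ of $M'$ means that $Y$ is obtained from $X$ by one application of the rules above for some pair $(i,j)$. *)

(* Defs.v *)
From mathcomp Require Import all_boot all_order all_algebra.
Set Implicit Arguments.
Unset Strict Implicit.
Unset Printing Implicit Defensive.
Import Order.TTheory GRing.Theory Num.Theory.

(* The vertex set {1, ..., N} is represented by 'I_N. *)
Definition digraph (N : nat) := {set 'I_N * 'I_N}.

Definition arc (N : nat) (X : digraph N) : rel 'I_N :=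
  [rel i j | (i, j) \in X].

Definition edge (N : nat) (X : digraph N) : rel 'I_N :=
  [rel i j | ((i, j) \in X) || ((j, i) \in X)].

(* The circuit v_0, v_1, ..., v_k = v_0 is given by v = v_0 and
   p = [:: v_1; ...; v_k] with k >= 1; a loop is thus a circuit with k = 1. *)
Definition acyclic (N : nat) (X : digraph N) : Prop :=
  ~ exists (v : 'I_N) (p : seq 'I_N),
      [/\ (0 < size p)%N, path (arc X) v p & last v p = v].

(* Decision procedure for [acyclic]; see [acyclicP]. *)
Definition acyclicb (N : nat) (X : digraph N) : bool :=
  [forall a in X, ~~ connect (arc X) a.2 a.1].

Lemma acyclicP (N : nat) (X : digraph N) : reflect (acyclic X) (acyclicb X).
Proof.
apply: (iffP forall_inP) => [acX [v [[|w p] []//= _ /andP[vw wp] lv]]|acX].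
  by case/negP: (acX _ vw); apply/connectP; exists p.
case=> v w vw; apply/negP=> /= /connectP[p wp lv].
by apply: acX; exists v, (w :: p); split=> //=; rewrite wp andbT.
Qed.

Definition simply_connected (N : nat) (X : digraph N) : bool :=
  [forall i, forall j, connect (edge X) i j].

Definition disconnecting (N : nat) (X : digraph N) (a : 'I_N * 'I_N) : bool :=
  ~~ simply_connected (X :\ a).

Definition state (N : nat) (X : digraph N) : Prop :=
  simply_connected X /\ acyclic X.

Definition step (N : nat) (X : digraph N) (a : 'I_N * 'I_N) : digraph N :=
  if a \in X then
    if ~~ disconnecting X a then X :\ a
    else (a.2, a.1) |: (X :\ a)
  else if acyclicb (a |: X) then a |: X else X.

(* One-step probability of the chain, the pair being uniform on V x V. *)
Definition kernel (N : nat) (X Y : digraph N) : rat :=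
  (#|[set a | step X a == Y]|%:R / #|{: 'I_N * 'I_N}|%:R)%R.

Definition transition (N : nat) : rel (digraph N) :=
  [rel X Y | [exists a, Y == step X a]].

(* G = G_0 -> G_1 -> ... -> G_p = H with every G_k a state. *)
Definition transition_sequence (N : nat) (G H : digraph N) (p : nat) : Prop :=
  exists s : seq (digraph N),
    [/\ size s = p, path (@transition N) G s, last G s = H
      & forall X, X \in G :: s -> state X].

Definition irreducible (N : nat) : Prop :=
  forall G H : digraph N, state G -> state H ->
    exists p : nat, (1 <= p)%N /\ transition_sequence G H p.

Lemma transition_kernel (N : nat) (X Y : digraph N) :
  transition X Y = (0 < kernel X Y)%R.
Proof.
apply/existsP/idP => [[a /eqP ->]|].
  by rewrite /kernel divr_gt0 // ltr0n; apply/card_gt0P; exists a; rewrite ?inE.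
case: (set_0Vmem [set a | step X a == Y]) => [|[a]].
  by rewrite /kernel => ->; rewrite cards0 mul0r ltxx.
by rewrite inE eq_sym => aY _; exists a.
Qed.

Lemma connect_add (N : nat) (Z : digraph N) (u v x y : 'I_N) :
  connect (arc ((u, v) |: Z)) x y ->
  connect (arc Z) x y || (connect (arc Z) x u && connect (arc Z) v y).
Proof.
case/connectP=> p; elim: p x => [|w p IH] x /=; first by move=> _ ->; rewrite connect0.
rewrite {1}/arc /= => /andP[]; rewrite in_setU1 => /predU1P[[-> ->]|xw] wp ly.
  by rewrite connect0 /=; case/orP: (IH _ wp ly) => [->|/andP[_ ->]]; rewrite orbT.
have cxw : connect (arc Z) x w by apply: connect1.
case/orP: (IH _ wp ly) => [h|/andP[h ->]]; first by rewrite (connect_trans cxw h).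
by rewrite (connect_trans cxw h) orbT.
Qed.

Lemma acyclicb_add (N : nat) (Z : digraph N) (u v : 'I_N) :
  acyclicb Z -> ~~ connect (arc Z) v u -> acyclicb ((u, v) |: Z).
Proof.
move=> acZ nvu; apply/forall_inP => -[x y] /=; rewrite !inE => xy.
apply/negP=> /connect_add; case/predU1P: xy => [[-> ->]|xy].
  by rewrite (negPf nvu).
rewrite (negPf (forall_inP acZ _ xy)) /= => /andP[yu vx].
by case/negP: nvu; apply: connect_trans vx (connect_trans (connect1 xy) yu).
Qed.

Lemma acyclicb_sub (N : nat) (Z X : digraph N) :
  Z \subset X -> acyclicb X -> acyclicb Z.
Proof.
move=> /subsetP sZX acX; apply/forall_inP => a aZ.
apply: contra (forall_inP acX _ (sZX _ aZ)); apply: connect_sub => x y xy.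
by apply/connect1/sZX.
Qed.

Lemma simply_connected_sub (N : nat) (X Y : digraph N) :
  (forall i j, (i, j) \in X -> connect (edge Y) i j) ->
  simply_connected X -> simply_connected Y.
Proof.
move=> sXY /forallP scX; apply/forallP=> i; apply/forallP=> j.
have symY : connect_sym (edge Y).
  by apply: sym_connect_sym => x y; rewrite /edge /= orbC.
move: (forallP (scX i) j); apply: connect_sub => x y /orP[/sXY //|/sXY].
by rewrite symY.
Qed.

Lemma step_state (N : nat) (X : digraph N) (a : 'I_N * 'I_N) :
  state X -> state (step X a).
Proof.
case=> scX /acyclicP acX; case: a => i j; rewrite /step.
case: ifP => [ijX|_]; last first.
  case: ifP => [/acyclicP ac|_]; last by split=> //; apply/acyclicP.
  split=> //; apply: simply_connected_sub scX => x y xy; apply: connect1.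
  by rewrite /edge /= !inE xy orbT.
have acD : acyclicb (X :\ (i, j)) by apply: acyclicb_sub acX; apply: subsetDl.
case: ifP => [|/negbFE dis]; first by rewrite /disconnecting negbK => scD; split=> //; apply/acyclicP.
split.
  apply: simply_connected_sub scX => x y xy; apply: connect1.
  rewrite /edge /= !inE xy andbT.
  by case: ((x, y) =P (i, j)) => [[-> ->]|_]; rewrite ?eqxx !orbT.
apply/acyclicP/acyclicb_add => //=; apply: contra dis => cij.
apply: simply_connected_sub scX => x y xy.
case: ((x, y) =P (i, j)) => [[-> ->]|/eqP nxy].
  by apply: connect_sub cij => u v uv; apply: connect1; apply/orP; left.
by apply: connect1; rewrite /edge /= !inE nxy xy.
Qed.

(* [kernel] restricted to the states is stochastic, so the chain lives on them. *)
Lemma kernel_stochastic (N : nat) (X : digraph N) :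
  (0 < N)%N -> state X ->
  (\sum_(Y | simply_connected Y && acyclicb Y) kernel X Y = 1)%R.
Proof.
move=> N_gt0 sX; rewrite /kernel -mulr_suml -natr_sum.
have -> : \sum_(Y | simply_connected Y && acyclicb Y) #|[set a | step X a == Y]|
          = #|{: 'I_N * 'I_N}|.
  rewrite -sum1_card (partition_big (step X)
    (fun Y => simply_connected Y && acyclicb Y)) /=; last first.
    by move=> a _; case: (step_state a sX) => -> /acyclicP ->.
  by apply: eq_bigr => Y _; rewrite -sum1_card; apply: eq_bigl => a; rewrite inE.
by rewrite divff // pnatr_eq0 card_prod card_ord muln_eq0 negb_or -!lt0n N_gt0.
Qed.

(* Main.v *)
Require Import Defs.
From mathcomp Require Import all_boot all_order all_algebra.
From mathcomp Require Import zify lra.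
Set Implicit Arguments.
Unset Strict Implicit.
Unset Printing Implicit Defensive.
Import GRing.Theory Num.Theory.

(** Let [T] be a minimal connected subdigraph of [H]. From [G], first add every
    missing edge of [T], in whichever direction keeps the digraph acyclic; then
    remove all arcs lying outside the underlying graph of [T], none of which is
    disconnecting. By minimality every arc is now disconnecting, so the arcs
    oriented against [T] can be reversed one by one; finally add the arcs of
    [H] that are not in [T]. An acyclic digraph has at most [N (N - 1) / 2]
    arcs, so the four phases take at most
    [|T| + (N (N - 1) / 2 - |T|) + |T| + (|H| - |T|) <= N (N - 1)] steps. *)

Section Digraphs.
Variable N : nat.
Implicit Types X Y T H : digraph N.

Definition swap (a : 'I_N * 'I_N) := (a.2, a.1).

Lemma swapK : involutive swap.
Proof. by case. Qed.

(** The underlying undirected graph, kept as a symmetric set of ordered pairs, so that equality up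
    to orientation of arcs becomes the set equality [sym X = sym T]. *)
Definition sym X : digraph N := [set a | (a \in X) || (swap a \in X)].

Lemma sym_swap X a : (swap a \in sym X) = (a \in sym X).
Proof. by rewrite !inE swapK orbC. Qed.

Lemma sym_subset X Y : X \subset sym Y -> sym X \subset sym Y.
Proof.
move=> /subsetP sXY; apply/subsetP=> a; rewrite inE => /orP[/sXY //|/sXY].
by rewrite sym_swap.
Qed.

Lemma simply_connected_sym X Y :
  X \subset sym Y -> simply_connected X -> simply_connected Y.
Proof.
move=> /subsetP sXY; apply: simply_connected_sub => i j /sXY.
by rewrite inE => ij; apply: connect1.
Qed.

(** The two arcs would form a circuit of length two. At a loop [swap a] is [a] itself, so this also
    excludes loops. *)
Lemma acyclicb_swap X a : acyclicb X -> a \in X -> swap a \notin X.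
Proof.
move=> acX aX; apply: contra (forall_inP acX _ aX) => saX.
exact: connect1.
Qed.

Lemma card_sym X : acyclicb X -> #|sym X| = #|X|.*2.
Proof.
move=> acX; have -> : sym X = X :|: swap @: X.
  by rewrite (can_imset_pre _ swapK); apply/setP=> a; rewrite !inE.
rewrite cardsU card_imset ?addnn; last exact: can_inj swapK.
rewrite (_ : X :&: _ = set0) ?cards0 ?subn0 //; apply/setP=> a; rewrite !inE.
apply/negP=> /andP[aX /imsetP[b bX ab]].
by case/negP: (acyclicb_swap acX aX); rewrite ab swapK.
Qed.

Lemma acyclic_card X : acyclicb X -> #|X|.*2 <= N * N.-1.
Proof.
move=> acX; rewrite -card_sym //.
have /subset_leq_card : sym X \subset ~: [set (i, i) | i : 'I_N].
  apply/subsetP=> a aX; rewrite inE; apply/negP=> /imsetP[i _ ai].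
  have iX : (i, i) \in X by move: aX; rewrite ai inE /swap /= orbb.
  by case/negP: (acyclicb_swap acX iX).
rewrite [#|~: _|]cardsCs setCK card_prod card_imset ?card_ord; last by move=> i j [].
by rewrite -subn1 mulnBr muln1.
Qed.

(** At least one orientation of a missing edge can be added without creating a circuit, and each
    such step settles exactly one arc of [T]. *)
Lemma add_edges T X : state X -> acyclicb T ->
  exists s, [/\ size s = #|T :\: sym X| & T \subset sym (foldl (@step N) X s)].
Proof.
move=> stX acT; have [n] := ubnP #|T :\: sym X|; elim: n => // n IH in X stX *.
case: (set_0Vmem (T :\: sym X)) => [TX _|[a aTX] ltn].
  by exists [::]; rewrite TX cards0; split=> //; rewrite -setD_eq0 TX.
have [aT] : a \in T /\ a \notin sym X by move: aTX; rewrite inE => /andP[].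
rewrite inE negb_or => /andP[naX nsX].
have [_ /acyclicP acX] := stX.
have a12 : a.1 != a.2.
  by apply/eqP => a12; move: (forall_inP acT _ aT); rewrite a12 connect0.
have [b bX ab] : exists2 b, step X b = b |: X & (b == a) || (b == swap a).
  have [c21|c21] := boolP (connect (Defs.arc X) a.2 a.1); last first.
    exists a; rewrite ?eqxx // /step (negPf naX).
    by case: {aT aTX naX nsX a12} a c21 => i j c21; rewrite acyclicb_add.
  (* Here [a.2] already reaches [a.1] in [X]. If [a.1] also reached [a.2], the two paths would close
     a circuit in [X], so the reversed arc is safe. *)
  exists (swap a); rewrite ?eqxx ?orbT // /step (negPf nsX).
  rewrite acyclicb_add //; apply/negP => c12.
  case/connectP: c21 => -[|v p] /=; first by move=> _ e; rewrite e eqxx in a12.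
  case/andP=> av vp ep; case/negP: (forall_inP acX _ av) => /=.
  by apply: connect_trans c12; apply/connectP; exists p.
have symb : sym (step X b) = a |: (swap a |: sym X).
  apply/setP=> c; rewrite bX !inE (inv_eq swapK c).
  case/orP: ab => /eqP ->; rewrite ?swapK;
  by case: (c == a); case: (c == swap a); rewrite ?orbT.
(* Only [a] is settled: [swap a] also enters [sym], but acyclicity keeps it out of [T]. *)
have eqD : T :\: sym (step X b) = (T :\: sym X) :\ a.
  apply/setP=> c; rewrite symb !inE !negb_or.
  case: eqP => [->|_] //=; case: eqP => [->|_] //=.
  by rewrite (negPf (acyclicb_swap acT aT)) !andbF.
have cD : #|T :\: sym X| = #|T :\: sym (step X b)|.+1 by rewrite eqD (cardsD1 a) aTX.
have [|s [ss sT]] := IH (step X b) (step_state b stX); first by rewrite -ltnS -cD.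
by exists (b :: s); rewrite /= ss cD.
Qed.

(** Deleting an arc outside [sym T] leaves every edge of the connected [T] in place, so such an arc
    is never disconnecting. *)
Lemma remove_arcs T X : simply_connected T -> T \subset sym X ->
  exists s, [/\ size s = #|X :\: sym T| & foldl (@step N) X s = X :&: sym T].
Proof.
move=> scT; have [n] := ubnP #|X :\: sym T|; elim: n => // n IH in X *.
case: (set_0Vmem (X :\: sym T)) => [XT _ _|[a aXT] ltn TX].
  exists [::]; rewrite XT cards0; split=> //=; symmetry; apply/setIidPl.
  by rewrite -setD_eq0 XT.
have [aX naT] : a \in X /\ a \notin sym T by move: aXT; rewrite inE => /andP[].
have TXa : T \subset sym (X :\ a).
  apply/subsetP=> c cT; move: (subsetP TX _ cT); rewrite !inE.
  case: eqP => [ca|_]; first by rewrite -ca inE cT in naT.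
  case: eqP => [ca|_] //=; by rewrite -ca sym_swap inE cT in naT.
have Xa : step X a = X :\ a.
  by rewrite /step aX /disconnecting negbK (simply_connected_sym TXa).
have eqD : (X :\ a) :\: sym T = (X :\: sym T) :\ a by rewrite !setDDl setUC.
have cD : #|X :\: sym T| = #|(X :\ a) :\: sym T|.+1 by rewrite eqD (cardsD1 a) aXT.
have [||s [ss sT]] := IH (X :\ a) => //; first by rewrite -ltnS -cD.
exists (a :: s); rewrite /= ss cD Xa sT; split=> //.
by rewrite setIDAC; apply/setDidPl; rewrite disjoint_sym disjoints1 inE (negPf naT) andbF.
Qed.

(** Since [X] has the edges of the minimal [T], each of its wrongly oriented arcs is disconnecting,
    and drawing it reverses it without changing [sym X]. *)
Lemma reverse_arcs T X : state X -> minset (@simply_connected N) T ->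
  acyclicb T -> sym X = sym T ->
  exists s, [/\ size s = #|T :\: X| & foldl (@step N) X s = T].
Proof.
move=> stX /minsetP[scT minT] acT.
have [n] := ubnP #|T :\: X|; elim: n => // n IH in X stX *.
have [_ /acyclicP acX] := stX.
case: (set_0Vmem (T :\: X)) => [TX _ eXT|[a aTX] ltn eXT].
  exists [::]; rewrite TX cards0; split=> //=; apply/eqP; rewrite eqEsubset.
  have sTX : T \subset X by rewrite -setD_eq0 TX.
  rewrite sTX andbT; apply/subsetP=> a aX.
  have : a \in sym T by rewrite -eXT inE aX.
  rewrite inE => /orP[//|/(subsetP sTX) saX].
  by rewrite (negPf (acyclicb_swap acX aX)) in saX.
have [aT naX] : a \in T /\ a \notin X by move: aTX; rewrite inE => /andP[].
have saX : swap a \in X.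
  have : a \in sym X by rewrite eXT inE aT.
  by rewrite inE (negPf naX).
have Xa : step X (swap a) = a |: (X :\ swap a).
  rewrite /step saX; case: ifP => [|_]; last by case: (a).
  rewrite /disconnecting negbK => scX.
  have sXT : X :\ swap a \subset sym (T :\ a).
    apply/subsetP=> c; rewrite !inE => /andP[ca cX].
    have : c \in sym T by rewrite -eXT inE cX.
    rewrite inE (inv_eq swapK) (negPf ca) /=.
    by case: eqP => [ca'|_] //; rewrite ca' (negPf naX) in cX.
  (* If [X] stayed connected without [swap a], then [T :\ a] would be connected, and minimality
     would force it to equal [T]. *)
  have := minT _ (simply_connected_sym sXT scX) (subsetDl _ _).
  by move/setP/(_ a); rewrite !inE eqxx aT.
have eXaT : sym (a |: (X :\ swap a)) = sym T.
  rewrite -eXT; apply/setP=> c; rewrite !inE (inv_eq swapK) (inj_eq (can_inj swapK)).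
  case: (c =P a) => [->|_] /=; first by rewrite saX orbT.
  by case: (c =P swap a) => [->|_] //=; rewrite saX.
have eqD : T :\: (a |: (X :\ swap a)) = (T :\: X) :\ a.
  apply/setP=> c; rewrite !inE; case: (c =P a) => [->|_] //=.
  by case: (c =P swap a) => [->|_] //=; rewrite (negPf (acyclicb_swap acT aT)) !andbF.
have cD : #|T :\: X| = #|T :\: (a |: (X :\ swap a))|.+1 by rewrite eqD (cardsD1 a) aTX.
have [|||s [ss sT]] := IH (a |: (X :\ swap a)) => //.
- by rewrite -Xa; apply: step_state.
- by rewrite -ltnS -cD.
by exists (swap a :: s); rewrite /= ss cD Xa.
Qed.

(** Every intermediate digraph lies inside [H], hence is acyclic, so no addition is refused. *)
Lemma add_arcs X H : acyclicb H -> X \subset H ->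
  exists s, [/\ size s = #|H :\: X| & foldl (@step N) X s = H].
Proof.
move=> acH; have [n] := ubnP #|H :\: X|; elim: n => // n IH in X *.
case: (set_0Vmem (H :\: X)) => [HX _ sXH|[a aHX] ltn sXH].
  exists [::]; rewrite HX cards0; split=> //=; apply/eqP.
  by rewrite eqEsubset sXH -setD_eq0 HX eqxx.
have [aH naX] : a \in H /\ a \notin X by move: aHX; rewrite inE => /andP[].
have saH : a |: X \subset H by rewrite subUset sub1set aH.
have Xa : step X a = a |: X by rewrite /step (negPf naX) (acyclicb_sub saH).
have eqD : H :\: (a |: X) = (H :\: X) :\ a by rewrite setDDl setUC.
have cD : #|H :\: X| = #|H :\: (a |: X)|.+1 by rewrite eqD (cardsD1 a) aHX.
have [||s [ss sH]] := IH (a |: X) => //; first by rewrite -ltnS -cD.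
by exists (a :: s); rewrite /= ss cD Xa.
Qed.

Lemma foldl_state X s : state X -> state (foldl (@step N) X s).
Proof. by elim: s X => //= a s IH X stX; apply/IH/step_state. Qed.

Lemma steps_between G H : state G -> state H ->
  exists2 s, size s <= N * N.-1 & foldl (@step N) G s = H.
Proof.
move=> stG [scH /acyclicP acH].
have [T minT sTH] := minset_exists (P := @simply_connected N) scH.
have scT := minsetp minT; have acT := acyclicb_sub sTH acH.
have [s1 []] := add_edges stG acT.
have := foldl_state s1 stG; set X := foldl _ _ _ => stX sz1 sTX.
have [s2 [sz2 eY]] := remove_arcs scT sTX.
have := foldl_state s2 stX; rewrite eY => stY.
have [_ /acyclicP acX] := stX; have [_ /acyclicP acY] := stY.
have eYT : sym (X :&: sym T) = sym T.
  apply/eqP; rewrite eqEsubset sym_subset ?subsetIr //= sym_subset //.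
  apply/subsetP=> a aT; move: (subsetP sTX _ aT).
  by rewrite in_set => /orP[] aX; rewrite !inE aX ?swapK aT ?orbT.
have [s3 [sz3 eT]] := reverse_arcs stY minT acT eYT.
have [s4 [sz4 eH]] := add_arcs acH sTH.
exists (s1 ++ s2 ++ s3 ++ s4); last by rewrite !foldl_cat -/X eY eT.
(* Two acyclic digraphs with the same underlying graph have equally many arcs; hence the removal
   phase takes exactly [#|X| - #|T|] steps. *)
have cY : #|X :&: sym T| = #|T| by apply: double_inj; rewrite -!card_sym ?eYT.
have cX : #|X :\: sym T| + #|T| = #|X| by rewrite -cY addnC cardsID.
have cH : #|H :\: T| + #|T| = #|H| by rewrite -{2}(setIidPr sTH) addnC cardsID.
have c1 := subset_leq_card (subsetDl T (sym G)).
have c3 := subset_leq_card (subsetDl T (X :&: sym T)).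
have := acyclic_card acX; have := acyclic_card acH.
by rewrite !size_cat sz1 sz2 sz3 sz4; lia.
Qed.

Lemma foldl_transition_sequence X s : state X ->
  transition_sequence X (foldl (@step N) X s) (size s).
Proof.
move=> stX; exists (scanl (@step N) X s); split; first exact: size_scanl.
- by elim: s X {stX} => //= a s IH X; rewrite IH andbT; apply/existsP; exists a.
- by elim: s X {stX} => //= a s IH X; apply: IH.
elim: s X stX => [|a s IH] X stX Y; first by rewrite inE => /eqP ->.
rewrite inE => /predU1P[-> //|]; exact/IH/step_state.
Qed.

(** Drawing a diagonal pair is an idle move; it supplies a sequence of positive length from a state
    to itself. *)
Lemma step_loop X (i : 'I_N) : acyclicb X -> step X (i, i) = X.
Proof.
move=> acX; rewrite /step ifF; last first.
  by apply/negP=> iX; move: (acyclicb_swap acX iX); rewrite /swap iX.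
rewrite ifF //; apply/negP=> /acyclicb_swap/(_ (setU11 _ _)).
by rewrite /swap setU11.
Qed.

End Digraphs.

Theorem theorem1 (N : nat) (hN : (2 <= N)%N) :
  irreducible N /\
  (forall G H : digraph N, state G -> state H ->
    exists p : nat,
      [/\ (1 <= p)%N,
          (p%:R <= (N%:R + 7%:R) * (N%:R - 3%:R / 2%:R) :> rat)%R
        & transition_sequence G H p]).
Proof.
have main (G H : digraph N) : state G -> state H ->
    exists p, [/\ 1 <= p, p <= N * N.-1 & transition_sequence G H p].
  move=> stG stH; have [[|a s] sz eH] := steps_between stG stH; last first.
    exists (size (a :: s)); split=> //; rewrite -eH; exact: foldl_transition_sequence.
  have [_ /acyclicP acG] := stG.
  (* The empty list of draws means [G = H]; one idle draw at vertex 0 makes the length positive, and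
     [1 <= N * N.-1] because [2 <= N]. *)
  exists 1; split=> //; first by nia.
  have := foldl_transition_sequence [:: (Ordinal (ltnW hN), Ordinal (ltnW hN))] stG.
  by rewrite /= step_loop // -eH.
split=> [G H stG stH|G H stG stH]; have [p [p1 pN tp]] := main G H stG stH.
  by exists p.
exists p; split=> //.
have pN' : (p%:R <= N%:R * (N%:R - 1) :> rat)%R.
  by rewrite -(natrB _ (ltnW hN)) -natrM ler_nat subn1.
have N2 : (2%:R <= N%:R :> rat)%R by rewrite ler_nat.
(* The squares cancel: the claimed bound exceeds [N * (N - 1)] by [(13 * N - 21) / 2], which is
   positive for [2 <= N]. *)
by lra.
Qed.
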